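(* Let a binary erasure channel $W$ and a small $\varepsilon>0$ be given, and assign $n:=-5\log_2\varepsilon$ (regarded as an integer). Let $\mathcal T$ be the channel tree with root $W$ generated by the rule: apply the channel transformation $T$ to a vertex $w$ (i.e. give $w$ the two children $w^\flat$ and $w^\sharp$) if and only if $\operatorname{depth}(w)<n$ and $Y(w)>\varepsilon 2^{-n}$. Then $\mathcal T$ possesses block length $N=2^n=\varepsilon^{-5}$.
   Context: For a binary erasure channel $w$, let $Z(w)\in[0,1]$ denote its erasure probability (which coincides with its Bhattacharyya parameter) and let $Y(w)=\min\{Z(w),1-Z(w)\}$. The channel transformation $T$ (Arıkan's transformation) turns two independent copies of $w$ into one copy of $w^\flat$ and one copy of $w^\sharp$, which are binary erasure channels with $Z(w^\flat)=1-(1-Z(w))^2$ and $Z(w^\sharp)=Z(w)^2$. A channel tree is a rooted full binary tree (each vertex has zero or two children) whose vertices are channels, such that the children of every non-leaf vertex $w$ are $w^\flat$ and $w^\sharp$. The root has depth $0$; $\operatorname{depth}(w)$ is the distance of $w$ from the root; the depth of a tree is the depth of its deepest leaf (a single-vertex tree has depth $0$). The block length of a channel tree $\mathcal T$ is $N:=2^{\operatorname{depth}(\mathcal T)}$, the number of instances of the root channel that the circuit corresponding to $\mathcal T$ consumes.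
   Formalization: The root channel W is assumed to have 0 < Z(W) < 1 (for Z(W) = 0 or 1 the tree is a single vertex and the claim fails); ''small ε'' means below a bound depending on W, and n equals -5 log2 ε exactly. *)

(* Defs.v *)
From HB Require Import structures.
From mathcomp Require Import all_boot all_order all_algebra.
From mathcomp Require Import reals exp.

Set Implicit Arguments.
Unset Strict Implicit.
Unset Printing Implicit Defensive.

Import Order.TTheory GRing.Theory Num.Theory.
Local Open Scope ring_scope.

(** A binary erasure channel is determined by its erasure probability [bec_Z]:
    it outputs an erasure with that probability, and its input otherwise. *)
Record bec (R : realType) := Bec {
  bec_Z : R ;
  bec_Z01 : 0 <= bec_Z <= 1
}.

Definition bec_Y (R : realType) (w : bec R) : R :=
  Num.min (bec_Z w) (1 - bec_Z w).

Definition log2 (R : realType) (x : R) : R := ln x / ln 2.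

Lemma flat_Z01 (R : realType) (w : bec R) : 0 <= 1 - (1 - bec_Z w) ^+ 2 <= 1.
Proof.
have /andP[z0 z1] := bec_Z01 w.
have u0 : 0 <= 1 - bec_Z w by rewrite subr_ge0.
by rewrite subr_ge0 exprn_ile1 ?gerBl ?exprn_ge0.
Qed.

Lemma sharp_Z01 (R : realType) (w : bec R) : 0 <= bec_Z w ^+ 2 <= 1.
Proof.
have /andP[z0 z1] := bec_Z01 w.
by rewrite exprn_ge0 ?exprn_ile1.
Qed.

(** Arikan's transformation sends two copies of a binary erasure channel [w]
    to the binary erasure channels [bec_flat w] and [bec_sharp w]. *)
Definition bec_flat (R : realType) (w : bec R) : bec R := Bec (flat_Z01 w).
Definition bec_sharp (R : realType) (w : bec R) : bec R := Bec (sharp_Z01 w).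

Inductive tree (V : Type) : Type :=
| Leaf of V
| Node of V & tree V & tree V.

Definition root_label (V : Type) (t : tree V) : V :=
  match t with Leaf v => v | Node v _ _ => v end.

Fixpoint tree_depth (V : Type) (t : tree V) : nat :=
  match t with
  | Leaf _ => 0
  | Node _ l r => (maxn (tree_depth l) (tree_depth r)).+1
  end.

Fixpoint channel_tree (R : realType) (t : tree (bec R)) : Prop :=
  match t with
  | Leaf _ => True
  | Node w l r =>
      [/\ root_label l = bec_flat w, root_label r = bec_sharp w,
          channel_tree l & channel_tree r]
  end.

Definition block_length (R : realType) (t : tree (bec R)) : nat :=
  (2 ^ tree_depth t)%N.

(** When the root of [t] is placed at depth [d], a vertex [w] of [t] at depth
    [k] has children if and only if [rule k w] holds. *)
Fixpoint obeys_from (V : Type) (rule : nat -> V -> Prop) (d : nat)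
    (t : tree V) : Prop :=
  match t with
  | Leaf w => ~ rule d w
  | Node w l r =>
      [/\ rule d w, obeys_from rule d.+1 l & obeys_from rule d.+1 r]
  end.

Definition generated_tree (R : realType) (W : bec R)
    (rule : nat -> bec R -> Prop) (t : tree (bec R)) : Prop :=
  [/\ channel_tree t, root_label t = W & obeys_from rule 0 t].

Definition threshold_rule (R : realType) (eps : R) (n : nat) (d : nat)
    (w : bec R) : Prop :=
  (d < n)%N /\ eps * 2 ^- n < bec_Y w.

Lemma generated_tree_exists_unique (R : realType) (W : bec R) (eps : R)
    (n : nat) :
  exists! t, generated_tree W (threshold_rule eps n) t.
Proof.
suff H k d (w : bec R) : (d + k)%N = n ->
    exists! t, [/\ channel_tree t, root_label t = w &
                   obeys_from (threshold_rule eps n) d t].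
  exact: (H n 0%N W).
elim: k d w => [|k IH] d w dk.
- have nr v : ~ threshold_rule eps n d v by case; rewrite -dk addn0 ltnn.
  exists (Leaf w); split=> [|[v|v l r]]; first by split=> //; exact: nr.
  + by case=> _ /= -> .
  + by case=> _ _ /= [/nr].
have dn : (d < n)%N by rewrite -dk -addSnnS leq_addr.
case: (boolP (eps * 2 ^- n < bec_Y w)) => hw; last first.
  have nr : ~ threshold_rule eps n d w by case=> _; exact/negP.
  exists (Leaf w); split=> [|[v|v l r]] //.
  + by case=> _ /= ->.
  + by case=> _ /= -> [/nr].
have dk' : (d.+1 + k)%N = n by rewrite addSnnS.
have [l [[cl rl ol] ul]] := IH d.+1 (bec_flat w) dk'.
have [r [[cr rr or_] ur]] := IH d.+1 (bec_sharp w) dk'.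
exists (Node w l r); split=> [|[v|v l' r']].
- by [].
- by case=> _ /= ->; case.
- case=> /= [[rl' rr' cl' cr'] vw [_ ol' or']]; subst v.
  by rewrite (ul l') // (ur r').
Qed.

(* Main.v *)
Require Import Defs.
From mathcomp Require Import all_boot all_order all_algebra.
From mathcomp Require Import reals exp.
From mathcomp Require Import ring lra.

(** From every channel one of the two children keeps the erasure probability
    away from 0 and 1: squaring [Z] when [Z >= 1/2] and squaring [1 - Z]
    otherwise never decreases [Y] below [min (Y w) (1/4)].  Following such
    children from the root, [Y] stays above the positive constant
    [min (Y W) (1/4)], hence above [eps * 2 ^- n] once [eps] is below that
    constant, so this branch is only stopped at depth [n]. *)

Import Order.TTheory GRing.Theory Num.Theory.
Local Open Scope ring_scope.

Lemma bec_Y_child (R : realType) (m : R) (w : bec R) :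
  m <= 4^-1 -> m <= bec_Y w ->
  m <= bec_Y (bec_flat w) \/ m <= bec_Y (bec_sharp w).
Proof.
rewrite /bec_Y /= !le_min => m4 /andP[mZ mZ'].
have /andP[Z0 Z1] := bec_Z01 w.
(* If Z >= 1/2, then Z^2 >= 1/4 and 1 - Z^2 >= 1 - Z; the other case is symmetric under exchanging Z
   and 1 - Z. *)
have [Zhalf|Zhalf] := leP 2^-1 (bec_Z w).
- by right; apply/andP; split; nra.
- by left; apply/andP; split; nra.
Qed.

Lemma tree_depth_le (V : Type) (rule : nat -> V -> Prop) (n : nat) :
  (forall d v, rule d v -> (d < n)%N) ->
  forall (t : tree V) d, obeys_from rule d t -> (tree_depth t <= n - d)%N.
Proof.
move=> rule_lt; elim=> [v|v l IHl r IHr] d //= [/rule_lt dn /IHl hl /IHr hr].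
by rewrite -(subnSK dn) ltnS geq_max hl.
Qed.

(** The induction keeps [m] fixed: one child inherits the bound on [bec_Y], and its depth alone
    bounds the maximum from below. *)
Lemma tree_depth_threshold_ge (R : realType) (m eps : R) (n : nat) :
  m <= 4^-1 -> eps * 2 ^- n < m ->
  forall (t : tree (bec R)) d, channel_tree t -> m <= bec_Y (root_label t) ->
    obeys_from (threshold_rule eps n) d t -> (n - d <= tree_depth t)%N.
Proof.
move=> m4 eps_m; elim=> [w|w l IHl r IHr] d /=.
  (* A leaf with [d < n] would satisfy the rule, so [n - d] truncates to 0. *)
  move=> _ mw stop; rewrite leqn0 subn_eq0 leqNgt; apply/negP => dn.
  by apply: stop; split=> //; exact: lt_le_trans mw.
move=> [rl rr cl cr] mw [[dn _] ol or_].
rewrite -(subnSK dn) ltnS leq_max.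
have [mf|ms] := bec_Y_child _ _ _ m4 mw.
- by rewrite IHl // rl.
- by rewrite (IHr d.+1) ?orbT // rr.
Qed.

Lemma expr2_log2 (R : realType) (eps : R) (n : nat) :
  0 < eps -> n%:R = - 5 * log2 eps -> 2 ^+ n = eps ^- 5.
Proof.
move=> eps0 nE.
have ln2 : ln 2 != 0 :> R by rewrite gt_eqF // ln_gt0 // ltr1n.
(* After taking logarithms, [ln 2] cancels and both sides are [- 5 * ln eps]. *)
apply: ln_inj; rewrite ?posrE ?invr_gt0 ?exprn_gt0 //.
rewrite lnV ?posrE ?exprn_gt0 // !lnXn // -(mulr_natl (ln 2)) -(mulr_natl (ln eps)) nE /log2.
by field.
Qed.

Theorem proposition5 (R : realType) (W : bec R) (hW : 0 < bec_Z W < 1) :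
  exists eps0 : R, 0 < eps0 /\
    forall (eps : R) (n : nat) (T : tree (bec R)),
      0 < eps -> eps < eps0 ->
      n%:R = - 5 * log2 eps ->
      generated_tree W (threshold_rule eps n) T ->
      block_length T = (2 ^ n)%N /\ 2 ^+ n = eps ^- 5 :> R.
Proof.
have /andP[Z0 Z1] := hW.
exists (Num.min (bec_Y W) 4^-1); split.
  by rewrite /bec_Y !lt_min Z0 subr_gt0 Z1 invr_gt0 ltr0n.
move=> eps n T eps_gt0 eps_lt nE [chT rootT obT]; split; last exact: expr2_log2.
congr (2 ^ _)%N; apply/eqP; rewrite eqn_leq; apply/andP; split.
  rewrite -[leqRHS]subn0; apply: tree_depth_le obT.
  by move=> d v [].
rewrite -[leqLHS]subn0.
apply: (tree_depth_threshold_ge _ (Num.min (bec_Y W) 4^-1) eps) obT => //.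
- by rewrite ge_min lexx orbT.
- apply: le_lt_trans eps_lt.
  (* The threshold is at most [eps], since [2 ^- n <= 1]. *)
  by rewrite ler_piMr ?(ltW eps_gt0) // invf_le1 ?exprn_gt0 // exprn_ege1 ?ler1n.
- by rewrite rootT ge_min lexx.
Qed.
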